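(* Let $\varphi\in\mathcal{C}^1(E,\mathbb{R})$ and $A\subset E$. If there exists $\rho>0$ such that $$a:=\inf_{v\in M\cap A}\varphi(v)<b:=\inf_{v\in M\cap(A_\rho\setminus A)}\varphi(v),$$ then, for every $\varepsilon\in(0,(b-a)/2)$, $\delta\in(0,\rho/2)$ and $w\in M\cap A$ such that $\varphi(w)\le a+\varepsilon$, there exists $u\in M$ such that (i) $a-2\varepsilon\le\varphi(u)\le a+2\varepsilon$; (ii) $\|u-w\|_E\le2\delta$; (iii) $\left\|\varphi|_M'(u)\right\|\le8\varepsilon/\delta$.
   Context: $H$ is a real Hilbert space with scalar product $(\cdot,\cdot)_H$ and norm $\|\cdot\|_H$, $E$ is a real Banach space with norm $\|\cdot\|_E$, both infinite dimensional, with continuous injections $E\hookrightarrow H\hookrightarrow E^*$ ($E^*$ the dual of $E$, $H$ identified with its dual). $M:=\{u\in E:\|u\|_H=1\}$ with the topology inherited from $E$; $T_uM=\{v\in E:(u,v)_H=0\}$ for $u\in M$. For $\varphi\in\mathcal{C}^1(E,\mathbb{R})$ and $u\in M$, $\|\varphi|_M'(u)\|:=\sup\{|\langle\varphi'(u),v\rangle|:v\in T_uM,\ \|v\|_E=1\}$. For $A\subset E$ and $\rho>0$, $A_\rho:=\{v\in E:\|u-v\|_E<\rho\text{ for some }u\in A\}$. *)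

(* Defs.v *)
From mathcomp Require Import all_boot all_order all_algebra.
From mathcomp Require Import sesquilinear.
From mathcomp Require Import all_classical all_reals all_analysis.

Set Implicit Arguments.
Unset Strict Implicit.
Unset Printing Implicit Defensive.

Import Order.TTheory GRing.Theory Num.Theory.
Import numFieldNormedType.Exports.

Local Open Scope classical_set_scope.
Local Open Scope ring_scope.

Definition infinite_dimensional (R : realType) (V : lmodType R) : Prop :=
  ~ exists (n : nat) (e : 'I_n -> V),
      forall v, exists c : 'I_n -> R, v = \sum_(i < n) c i *: e i.

(* A Hilbert space is a [completeNormedModType] together with a (real,
   symmetric, positive definite) scalar product inducing its norm. *)
Definition norm_of_dot (R : realType) (H : completeNormedModType R)
    (dotH : {dot H for idfun}) : Prop :=
  forall x : H, `|x| ^+ 2 = dotH x x.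

(* sup {|f v| : v \in V, |v| = 1}, as an extended real. *)
Definition norm_on (R : realType) (E : normedModType R) (V : set E)
    (f : E -> R) : \bar R :=
  ereal_sup [set `|f v|%:E | v in V `&` [set v | `|v| = 1]].

Definition dual_norm (R : realType) (E : normedModType R) (f : E -> R) :
  \bar R := norm_on setT f.

(* Continuity of a map [F] from [T] to the dual of [E] with its norm topology;
   [F] is meant to take bounded linear functionals as values. *)
Definition continuous_to_dual (R : realType) (T : topologicalType)
    (E : normedModType R) (F : T -> E -> R) : Prop :=
  forall x : T, dual_norm (fun v => F y v - F x v) @[y --> x] --> 0%E.

(* [phi] is Frechet differentiable with norm-continuous derivative
   (differentiability in the library includes the continuity of ['d phi u]). *)
Definition C1 (R : realType) (E : normedModType R) (phi : E -> R) : Prop :=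
  (forall u : E, differentiable phi u) /\
  continuous_to_dual (fun u v : E => 'd phi u v).

Section Embedding.
Variables (R : realType) (H E : completeNormedModType R).
Variables (dotH : {dot H for idfun}) (j : {linear E -> H}).

(* E -> H -> E^*, both maps continuous and injective. The second one sends h to
   the functional v |-> (h, j v)_H, H being identified with its dual. *)
Definition continuous_injections : Prop :=
  [/\ continuous j, injective j,
      continuous_to_dual (fun (h : H) (v : E) => dotH h (j v)) &
      injective (fun (h : H) (v : E) => dotH h (j v))].

Definition sphere_H : set E := [set u | `|j u| = 1].

Definition tangent_space (u : E) : set E := [set v | dotH (j u) (j v) = 0].

Definition constrained_norm (phi : E -> R) (u : E) : \bar R :=
  norm_on (tangent_space u) ('d phi u).

End Embedding.

Definition open_neighborhood (R : realType) (E : normedModType R) (A : set E)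
    (rho : R) : set E :=
  [set v | exists2 u, A u & `|u - v| < rho].

(* The infimum is taken in the extended reals: it is -oo when [phi] is not
   bounded below on [S] and +oo when [S] is empty. *)
Definition inf_on (R : realType) (E : Type) (S : set E) (phi : E -> R) :
  \bar R := ereal_inf [set (phi v)%:E | v in S].

(* Main.v *)
Require Import Defs.
From mathcomp Require Import all_boot all_order all_algebra.
From mathcomp Require Import sesquilinear.
From mathcomp Require Import all_classical all_reals all_analysis.
From mathcomp Require Import ring lra.

Set Implicit Arguments.
Unset Strict Implicit.
Unset Printing Implicit Defensive.

Import Order.TTheory GRing.Theory Num.Theory.
Import numFieldNormedType.Exports.

Local Open Scope classical_set_scope.
Local Open Scope ring_scope.

(** The point [w] almost minimizes [phi] on the part [D] of [M] lying in the
    closed ball of radius [2 * delta] around it: a point of [D] is either in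
    [A], where [phi] is at least [a], or in the [rho]-neighborhood of [A] but
    not in [A], where [phi] is at least [b > a]; so [phi >= a] on [D] whereas
    [phi w <= a + eps].  As [D] is complete, Ekeland's variational principle
    ([ekeland]) with slope [eps / delta] gives a point [u] of [D] at which
    [phi u + (eps / delta) * `|u - w| <= phi w], and below which no point of
    [D] lies in the sense that [phi v + (eps / delta) * `|v - u| <= phi u]
    forces [v = u].  The first property bounds [phi u] and shows
    [`|u - w| <= delta], so that [D] contains all points of [M] near [u].

    It remains to turn the second property into a bound on the derivative along
    [M].  Every tangent vector [v] at [u] is the velocity of the curve
    [t |-> (u + t v) / `|u + t v|_H] of [M] ([sphere_H_curve]), and along it
    [phi] cannot decrease faster than [eps / delta] times the distance
    travelled, whence ['d phi u v >= - (eps / delta) * `|v|]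
    ([diff_ge_along_curve]).  Using [- v] as well, the constrained norm of the
    derivative is at most [eps / delta] ([constrained_norm_le]), which is
    better than the required [8 * eps / delta].  *)

(** * Ekeland's variational principle *)

(** Closed sublevel sets in [D] are what keeps in [D] the limit of a sequence
    along which [f] is bounded above; a lower semicontinuous [f] on a closed [D]
    has them.  The relation [f y + k * `|y - x| <= f x] is a partial order on
    [D], with [y] below [x]; starting from [w], the proof repeatedly moves to a
    lower point whose value at least halves the gap to the infimum of [f] over
    all lower points.  The points form a Cauchy sequence because their distances
    are controlled by the decreasing values of [f], and the gap closes, so the
    limit is minimal. *)
Lemma ekeland (R : realType) (E : completeNormedModType R) (D : set E)
    (f : E -> R) (m k : R) (w : E) :
  (forall r, closed (D `&` [set x | f x <= r])) ->
  (forall x, D x -> m <= f x) -> 0 < k -> D w ->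
  exists u, [/\ D u, f u + k * `|u - w| <= f w &
    forall v, D v -> f v + k * `|v - u| <= f u -> v = u].
Proof.
move=> Dcl mf k0 Dw.
pose S x y := D y /\ f y + k * `|y - x| <= f x.
have Srefl x : D x -> S x x.
  by move=> Dx; split => //; rewrite subrr normr0 mulr0 addr0.
have Strans x y z : S x y -> S y z -> S x z.
  move=> [Dy xy] [Dz yz]; split=> //.
  apply: le_trans xy; apply: le_trans (lerD yz (lexx _)).
  by rewrite -addrA lerD2l -mulrDr ler_pM2l// ler_distD.
have Sle x y : S x y -> f y <= f x.
  by move=> [_]; apply: le_trans; rewrite lerDl mulr_ge0// ltW.
(* [f (g x) *+ 2 <= f x + f z] for all [z] below [x]: the value at [g x] is at
   most the midpoint of [f x] and the infimum over the points below [x]. *)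
have [g gP] : {g : E -> E & forall x, D x ->
    S x (g x) /\ forall z, S x z -> f (g x) *+ 2 <= f x + f z}.
  apply: (@choice _ _ (fun x y => D x ->
    S x y /\ forall z, S x z -> f y *+ 2 <= f x + f z)) => x.
  have [Dx|nDx] := pselect (D x); last by exists x.
  pose V := f @` S x.
  have Vinf : has_inf V.
    split; first by exists (f x), x => //; exact: Srefl.
    by exists m => _ [y [Dy _] <-]; exact: mf.
  have Vlb y : S x y -> inf V <= f y.
    by move=> Sxy; apply: ge_inf; [exact: Vinf.2|exists y].
  have [xV|Vx] := leP (f x) (inf V).
    exists x => _; split; first exact: Srefl.
    by move=> z /Vlb zV; rewrite mulr2n lerD2l (le_trans xV).
  have e0 : 0 < (f x - inf V) / 2 by rewrite divr_gt0// subr_gt0.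
  have [_ [y Sxy <-] yV] := inf_adherent e0 Vinf.
  exists y => _; split=> // z /Vlb zV; lra.
pose x_ n := iter n g w.
have Dx n : D (x_ n).
  by elim: n => //= n IH; have [[]] := gP _ IH.
have Sx n p : S (x_ n) (x_ (n + p)%N).
  elim: p => [|p IH]; first by rewrite addn0; exact: Srefl.
  by apply: Strans IH _; rewrite addnS; have [] := gP _ (Dx (n + p)%N).
have Sx_le n p : (n <= p)%N -> S (x_ n) (x_ p).
  by move=> /subnKC <-; exact: Sx.
pose L := inf (range (f \o x_)).
have fx_lb : has_lbound (range (f \o x_)).
  by exists m => _ [n _ <-]; exact: mf.
have fxL : f \o x_ @ \oo --> L.
  by apply: nonincreasing_cvgn => // n p /Sx_le/Sle.
have Lfx n : L <= f (x_ n) by apply: ge_inf => //; exists n.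
have kdist n p : (n <= p)%N -> k * `|x_ p - x_ n| <= f (x_ n) - L.
  by move=> /Sx_le[_]; have := Lfx p; lra.
have xcvg : cvg (x_ @ \oo).
  apply/cauchy_cvgP/cauchy_exP => e e0.
  have [N _ NP] : \forall n \near \oo, `|L - f (x_ n)| < k * e.
    by move/cvgrPdist_lt: fxL; apply; rewrite mulr_gt0.
  exists (x_ N), N => //= p /= Np.
  rewrite -ball_normE /= -(ltr_pM2l k0) distrC (le_lt_trans (kdist _ _ Np))//.
  by apply: le_lt_trans (NP N _) => //=; rewrite distrC ler_norm.
pose u := lim (x_ @ \oo).
(* The limit is below every [x_ n]; [e] absorbs the error made when
   [`|x_ p - x_ n|] is replaced by its limit [`|u - x_ n|] before passing to the
   limit in the sublevel set. *)
have Su n : S (x_ n) u.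
  suff Se e : 0 < e ->
      (D `&` [set y | f y <= f (x_ n) - k * `|u - x_ n| + e]) u.
    split; first by have [] := Se _ ltr01.
    by rewrite -lerBrDr; apply/ler_addgt0Pr => e /Se[].
  move=> e0; apply: (closed_cvg _ (Dcl _) _ _ xcvg).
  near=> p; split=> //=.
  have /Sx_le[_] : (n <= p)%N by near: p; exists n.
  suff : k * `|u - x_ n| <= k * `|x_ p - x_ n| + e by lra.
  have : k * `|u - x_ p| < e.
    rewrite -ltr_pdivlMl//; near: p.
    by move/cvgrPdist_lt: xcvg; apply; rewrite mulr_gt0 ?invr_gt0.
  have : k * `|u - x_ n| <= k * (`|u - x_ p| + `|x_ p - x_ n|).
    by rewrite ler_pM2l// ler_distD.
  lra.
have [Du uw] := Su 0%N.
exists u; split=> // v Dv vu.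
(* A point [v] below [u] is below every [x_ n], hence
   [f (x_ n.+1) *+ 2 <= f (x_ n) + f v], and both values tend to [L]. *)
have Lv : L <= f v.
  suff : L *+ 2 <= L + f v by rewrite mulr2n lerD2l.
  apply: (@ler_cvg_to _ \oo _ _ (fun n => f (x_ n.+1) *+ 2)
    (fun n => f (x_ n) + f v)).
  - apply: cvgMn; have := fxL; rewrite -(cvg_shiftS (f \o x_)); exact.
  - by apply: cvgD => //; exact: cvg_cst.
  - near=> n; have [_ ] := gP _ (Dx n); apply.
    exact: Strans (Su n) (conj Dv vu).
have uL : f u <= L.
  apply: lb_le_inf; first by exists (f (x_ 0%N)), 0%N.
  by move=> _ [n _ <-]; exact: Sle (Su n).
have : k * `|v - u| <= 0 by lra.
by rewrite pmulr_rle0// normr_le0 subr_eq0 => /eqP.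
Unshelve. all: by end_near. Qed.

(** * Derivatives along the sphere of [H] *)

(** The curve is the line [u + t v] projected radially onto the sphere.
    Orthogonality gives [`|u + t v|_H ^+ 2 = 1 + O(t ^+ 2)], so the projection
    changes the line only at second order and keeps its velocity, also for the
    stronger norm of [E]. *)
Lemma sphere_H_curve (R : realType) (H E : completeNormedModType R)
    (dotH : {dot H for idfun}) (dotH_norm : norm_of_dot dotH)
    (j : {linear E -> H}) (u v : E) :
  sphere_H j u -> tangent_space dotH j u v ->
  exists c : R -> E,
    [/\ c 0 = u, forall t, sphere_H j (c t) & is_derive (0 : R) 1 c v].
Proof.
rewrite /sphere_H /tangent_space /= => ju uv.
have dotC x y : dotH x y = dotH y x by rewrite hermC expr0 mul1r.
have dotD x y z : dotH x (y + z) = dotH x y + dotH x z by exact: raddfD.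
have dotZ a x y : dotH x (a *: y) = a * dotH x y by exact: linearZ.
pose q := `|j v| ^+ 2.
pose N t := `|j (u + t *: v)|.
have NE t : N t ^+ 2 = 1 + t ^+ 2 * q.
  rewrite /N /q linearD linearZ !dotH_norm dotD !(dotC (_ + _)) !dotD.
  rewrite !dotZ !(dotC (_ *: _)) !dotZ (dotC (j v)) uv -!dotH_norm ju; ring.
have q0 : 0 <= q by rewrite exprn_ge0.
have N1 t : 1 <= N t.
  rewrite -(@ler_pXn2r _ 2)// ?nnegrE//; last exact: normr_ge0.
  by rewrite expr1n NE lerDl mulr_ge0// sqr_ge0.
have N0 t : 0 < N t by rewrite (lt_le_trans ltr01).
(* As [1 <= N t], [`|(N t)^-1 - 1| <= N t - 1 <= N t ^+ 2 - 1]. *)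
have Nq t : `|(N t)^-1 - 1| <= t ^+ 2 * q.
  have -> : t ^+ 2 * q = N t ^+ 2 - 1 by rewrite NE; ring.
  have -> : (N t)^-1 - 1 = - ((N t - 1) / N t).
    by field; rewrite gt_eqF.
  rewrite normrN ger0_norm; last by rewrite divr_ge0// ?subr_ge0// ltW.
  rewrite ler_pdivrMr//; have := N1 t; nra.
pose c t := (N t)^-1 *: (u + t *: v).
have c0 : c 0 = u.
  by rewrite /c scale0r addr0 /N scale0r addr0 ju invr1 scale1r.
have Nq0 : \forall t \near (0 : R)^',
    - (`|t| * q) <= t^-1 * ((N t)^-1 - 1) <= `|t| * q.
  near=> t.
  have t0 : t != 0 by near: t; exact: nbhs_dnbhs_neq.
  rewrite -ler_norml normrM normfV ler_pdivrMl ?normr_gt0// mulrA.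
  by rewrite -normrM -expr2 (ger0_norm (sqr_ge0 t)) Nq.
have id0 : t @[t --> (0:R)^'] --> (0:R) by exact: cvg_within.
have tq0 : `|t| * q @[t --> (0:R)^'] --> 0.
  rewrite -[X in _ --> X](mul0r q); apply: cvgM; last exact: cvg_cst.
  rewrite -[X in _ --> X](normr0 R); exact: (cvg_norm id0).
have tN0 : t^-1 * ((N t)^-1 - 1) @[t --> (0 : R)^'] --> 0.
  by apply: (squeeze_cvgr Nq0 _ tq0); rewrite -[X in _ --> X]oppr0;
    exact: (cvgN tq0).
exists c; split=> //.
  move=> t; rewrite /sphere_H/= /c linearZ normrZ gtr0_norm ?invr_gt0//.
  by rewrite mulVf// gt_eqF.
have cv : h^-1 *: (c (h *: 1 + 0) - c 0) @[h --> 0^'] --> v.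
  have uv0 : u + h *: v @[h --> (0:R)^'] --> u.
    rewrite -[X in _ --> X](addr0 u) -(scale0r v).
    apply: cvgD; first exact: cvg_cst.
    exact: (cvgZr_tmp id0).
  (* [c h - u = h *: v + ((N h)^-1 - 1) *: (u + h *: v)] *)
  have lim_v :
      v + (h^-1 * ((N h)^-1 - 1)) *: (u + h *: v) @[h --> (0:R)^'] --> v.
    rewrite -[X in _ --> X]addr0 -(scale0r u).
    apply: cvgD; first exact: cvg_cst.
    exact: cvgZ tN0 uv0.
  apply: cvg_trans lim_v.
  apply: near_eq_cvg; near=> h.
  have h0 : h != 0 by near: h; exact: nbhs_dnbhs_neq.
  rewrite /= addr0 [h%:A]mulr1 c0 /c.
  apply: (scalerI h0); rewrite scalerDr !scalerA mulrA mulfV// !mul1r scale1r.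
  by rewrite scalerBl scale1r addrCA opprD [h *: v + (- u + _)]addrCA
    subrr addr0.
apply: DeriveDef; first by apply: cvgP cv.
by apply: cvg_lim cv.
Unshelve. all: by end_near. Qed.

Lemma is_derive_cvg_at_right (R : realType) (V : normedModType R) (f : R -> V)
    (df : V) :
  is_derive (0 : R) 1 f df ->
  h^-1 *: (f h - f 0) @[h --> (0 : R)^'+] --> df.
Proof.
move=> [/cvg_dnbhs_at_right]; rewrite -/(derive f 0 1) => + <-.
rewrite [X in fmap X](_ : _ = fun h => h^-1 *: (f h - f 0))//.
by apply/funext => h /=; rewrite addr0 [h%:A]mulr1.
Qed.

(** By the chain rule, [(phi (c t) - phi (c 0)) / t] tends to ['d phi (c 0) v]
    as [t] decreases to [0], while its lower bound [- (k * `|c t - c 0| / t)] tends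
    to [- (k * `|v|)]. *)
Lemma diff_ge_along_curve (R : realType) (E : normedModType R) (phi : E -> R)
    (c : R -> E) (v : E) (k : R) :
  differentiable phi (c 0) -> is_derive (0 : R) 1 c v ->
  (\forall t \near (0 : R)^'+, phi (c 0) - k * `|c t - c 0| <= phi (c t)) ->
  - (k * `|v|) <= 'd phi (c 0) v.
Proof.
move=> dphi dc phic; have [/derivable1_diffP diffc cv] := dc.
have dphic : is_derive (0 : R) 1 (phi \o c) ('d phi (c 0) v).
  have dphic : differentiable (phi \o c) 0 by exact: differentiable_comp.
  apply: DeriveDef; first exact/derivable1_diffP.
  by rewrite deriveE// diff_comp//= -cv deriveE.
have lim_v := is_derive_cvg_at_right dc.
have lim_dphi := is_derive_cvg_at_right dphic.
have lim_k :
    - (k * `|h^-1 *: (c h - c 0)|) @[h --> (0 : R)^'+] --> - (k * `|v|).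
  by apply: cvgN; apply: cvgMl_tmp; exact: cvg_norm lim_v.
apply: ler_cvg_to lim_k lim_dphi _; near=> t.
have t0 : 0 < t by near: t; exact: nbhs_right_gt.
rewrite normrZ gtr0_norm ?invr_gt0// mulrCA -mulrN ler_pM2l ?invr_gt0//.
by rewrite lerBrDr addrC; near: t; exact: phic.
Unshelve. all: by end_near. Qed.

(** Tangent spaces are symmetric, so the one-sided estimate along curves, used
    for [v] and [- v], bounds the absolute value. *)
Lemma constrained_norm_le (R : realType) (H E : completeNormedModType R)
    (dotH : {dot H for idfun}) (dotH_norm : norm_of_dot dotH)
    (j : {linear E -> H}) (phi : E -> R) (u : E) (k : R) :
  differentiable phi u -> sphere_H j u ->
  (\forall v \near u, sphere_H j v -> phi u - k * `|v - u| <= phi v) ->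
  (constrained_norm dotH j phi u <= k%:E)%E.
Proof.
move=> dphi Mu umin; apply: ge_ereal_sup => _ [v [uv v1] <-] /=.
have lower z : tangent_space dotH j u z -> - (k * `|z|) <= 'd phi u z.
  move=> uz; have [c [c0 Mc dc]] := sphere_H_curve dotH_norm Mu uz.
  rewrite -c0 in dphi umin *; apply: diff_ge_along_curve => //.
  have cc : c t @[t --> (0 : R)^'+] --> c 0.
    apply: cvg_at_right_filter; apply: differentiable_continuous.
    by apply/derivable1_diffP; case: dc.
  by near=> t; move: (Mc t); near: t; exact: (cc _ umin).
rewrite lee_fin ler_norml; apply/andP; split.
  by have := lower _ uv; rewrite v1 mulr1.
rewrite -lerN2 -linearN; have := lower (- v); rewrite normrN v1 mulr1; apply.
by rewrite /tangent_space/= linearN raddfN; apply/eqP; rewrite oppr_eq0; exact/eqP.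
Unshelve. all: by end_near. Qed.

(** * Almost critical points near almost minimizers *)

Theorem theorem2p7 (R : realType) (H E : completeNormedModType R)
    (dotH : {dot H for idfun}) (dotH_norm : norm_of_dot dotH)
    (H_infdim : infinite_dimensional H) (E_infdim : infinite_dimensional E)
    (j : {linear E -> H}) (j_inj : continuous_injections dotH j)
    (phi : E -> R) (phi_C1 : C1 phi) (A : set E) (rho : R) (rho_gt0 : 0 < rho) :
  let M := sphere_H j in
  let a := inf_on (M `&` A) phi in
  let b := inf_on (M `&` (open_neighborhood A rho `\` A)) phi in
  (a < b)%E ->
  forall (eps delta : R) (w : E),
    0 < eps -> (eps%:E < (b - a) * (2^-1)%:E)%E ->
    0 < delta -> delta < rho / 2 ->
    (M `&` A) w -> ((phi w)%:E <= a + eps%:E)%E ->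
    exists u : E,
      [/\ M u,
          (a - (2 * eps)%:E <= (phi u)%:E)%E /\
            ((phi u)%:E <= a + (2 * eps)%:E)%E,
          `|u - w| <= 2 * delta &
          (constrained_norm dotH j phi u <= (8 * eps / delta)%:E)%E].
Proof.
move=> M a b ab eps delta w eps0 _ delta0 delta_rho MAw wa.
have [Mw Aw] := MAw.
have dphi u : differentiable phi u by have [] := phi_C1.
have cphi : continuous phi by move=> u; exact: differentiable_continuous.
have cj : continuous j by have [] := j_inj.
have aw : (a <= (phi w)%:E)%E by apply: ereal_inf_lbound; exists w.
(* The infimum is finite: [-oo] is excluded by [phi w <= a + eps]. *)
have [a' aE] : exists a', a = a'%:E.
  by move: aw wa; case: (a) => [r|//|//]; exists r.
pose D := M `&` [set v | `|v - w| <= 2 * delta].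
have aD v : D v -> a' <= phi v.
  move=> [Mv vw]; rewrite -lee_fin -aE.
  have [Av|nAv] := pselect (A v); first by apply: ereal_inf_lbound; exists v.
  apply: (le_trans (ltW ab)); apply: ereal_inf_lbound; exists v => //.
  split=> //; split=> //; exists w => //.
  by rewrite distrC (le_lt_trans vw)// mulrC -ltr_pdivlMr.
have Dcl r : closed (D `&` [set x | phi x <= r]).
  apply: closedI; first apply: closedI.
  - apply: (@preimage_closed _ _ (fun x => `|j x|) [set 1]).
      by move=> x _; apply: continuous_comp; [exact: cj|exact: norm_continuous].
    exact: closed_eq.
  - apply: (@preimage_closed _ _ (fun x => `|x - w|) [set x | x <= _]).
      move=> x _; apply: cvg_norm; apply: cvgB; [exact: cvg_id|exact: cvg_cst].
    exact: closed_le.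
  - apply: (@preimage_closed _ _ phi [set x | x <= _]); last exact: closed_le.
    by move=> x _; exact: cphi.
have Dw : D w by split=> //=; rewrite subrr normr0 mulr_ge0// ltW.
have k0 : 0 < eps / delta by rewrite divr_gt0.
have [u [Du uw umin]] := ekeland Dcl aD k0 Dw.
have [Mu _] := Du.
have au := aD _ Du.
have wa' : phi w <= a' + eps by rewrite -lee_fin EFinD -aE.
have kuw : eps / delta * `|u - w| <= eps by lra.
have uwd : `|u - w| <= delta.
  by move: kuw; rewrite mulrAC -mulrA ger_pMr// ler_pdivrMr// mul1r.
have k_ge0 : 0 <= eps / delta * `|u - w| by rewrite mulr_ge0// ltW.
exists u; split=> //.
- by rewrite aE -EFinB -EFinD !lee_fin; split; lra.
- lra.
- apply: (@le_trans _ _ (eps / delta)%:E); last first.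
    by rewrite lee_fin -mulrA ler_peMl ?ltW//; lra.
  apply: constrained_norm_le => //; near=> v => Mv.
  have Dv : D v.
    split=> //=; rewrite -[v](subrK u) -addrA (le_trans (ler_normD _ _))//.
    by rewrite mulr2n mulrDl mul1r lerD.
  rewrite leNgt; apply/negP => phiv.
  have vu : v = u by apply: umin; rewrite // -lerBrDr ltW.
  by move: phiv; rewrite vu subrr normr0 mulr0 subr0 ltxx.
Unshelve. all: by end_near. Qed.
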